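(* Let $p\in\mathbb{N}$, $p\ge1$, and $q\in\mathbb{Z}$ be relatively prime, let $\omega\in\mathbb{R}$, let $r\ge 1$ be an integer and let $i_1\le i_2$ be integers. Define $$a:=\left\lceil (i_2-i_1)\,|q-\omega p|\right\rceil ,$$ where $\lceil\alpha\rceil$ is the smallest integer bigger than or equal to $\alpha$. Assume that $x\in\mathcal{B}_{\omega}$ is maximally periodic. Then there exists an $i_0\in\mathbb{Z}$ such that for all integers $m,n$ with $i_1+r\le i_0+mp\le i_2-r+1$ and $i_1+r\le i_0+np\le i_2-r+1$ we have $$\sum_{j=i_0-r}^{i_0+r-1}\left|x_{mp+j}-x_{np+j}-(m-n)q\right|\le\frac{2r\cdot a}{p}.$$
   Context: For $k,l\in\mathbb{Z}$ and $x\in\mathbb{R}^{\mathbb{Z}}$, the shift is $(\tau_{k,l}x)_i:=x_{i-k}+l$. Write $x\le y$ if $x_i\le y_i$ for all $i$. A sequence $x\in\mathbb{R}^{\mathbb{Z}}$ is Birkhoff if $\{\tau_{k,l}x\mid k,l\in\mathbb{Z}\}$ is totally ordered, i.e. for all $k,l\in\mathbb{Z}$ either $\tau_{k,l}x\ge x$ or $\tau_{k,l}x\le x$. Every Birkhoff sequence has a rotation number $\lim_{n\to\pm\infty}x_n/n$; $\mathcal{B}_{\omega}$ denotes the set of Birkhoff sequences with rotation number $\omega$. A sequence $x\in\mathcal{B}_{\omega}$ is maximally periodic if $\tau_{k,l}x=x$ for all $k,l\in\mathbb{Z}$ with $-\omega k+l=0$. *)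

(* Defs.v *)
From mathcomp Require Import all_boot all_order all_algebra.
From mathcomp Require Import archimedean.
From mathcomp Require Import all_classical all_reals all_analysis.

Set Implicit Arguments.
Unset Strict Implicit.
Unset Printing Implicit Defensive.

Import Order.TTheory GRing.Theory Num.Theory.
Import numFieldNormedType.Exports.

Local Open Scope classical_set_scope.
Local Open Scope ring_scope.

Definition shift (R : realType) (k l : int) (x : int -> R) : int -> R :=
  fun i => x (i - k) + l%:~R.

(* [<=] on [int -> R] is the library's pointwise order (see [lefP]). *)
Definition birkhoff (R : realType) (x : int -> R) : Prop :=
  forall k l : int, (x <= shift k l x)%O \/ (shift k l x <= x)%O.

(* The limit of [x n / n] as the integer [n] tends to [+oo] and to [-oo]. *)
Definition has_rotation_number (R : realType) (omega : R) (x : int -> R)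
    : Prop :=
  (fun n : nat => x n%:Z / n%:R) @ \oo --> omega /\
  (fun n : nat => x (- n%:Z) / (- n%:R)) @ \oo --> omega.

Definition birkhoff_rot (R : realType) (omega : R) : set (int -> R) :=
  [set x | birkhoff x /\ has_rotation_number omega x].

Definition maximally_periodic (R : realType) (omega : R) (x : int -> R)
    : Prop :=
  forall k l : int, - omega * k%:~R + l%:~R = 0 -> shift k l x = x.

(* Main.v *)
(** For a maximally periodic Birkhoff sequence the lifts [x i + l] are ordered
    like the numbers [omega * i + l], so [x i + l = F (omega * i + l)] for a
    nondecreasing [F] with [F (t + 1) = F t + 1].  Put [eps = omega - q / p].
    For [i = m * p + k] one has [omega * i - m * q = k * q / p + eps * i], so
    as long as [i1 <= i <= i2] the value [x i - m * q] lies between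
    [F (k * q / p + c)] and [F ((k * q + a) / p + c)], where [c] is the least
    value of [eps * i] on [[i1, i2]]: this is the choice of [a].  The difference
    [G k] of these bounds depends only on [k] modulo [p], and as [q] is
    invertible modulo [p], its sum over a period telescopes to [a].  Hence the
    sum of [G] over a window of length [2 * r] is on average [2 * r * a / p],
    and [i0] is a residue where it does not exceed the average. *)
Require Import Defs.
From mathcomp Require Import all_boot all_order all_algebra.
From mathcomp Require Import archimedean.
From mathcomp Require Import all_classical all_reals all_analysis.
From mathcomp Require Import zify ring lra.

Set Implicit Arguments.
Unset Strict Implicit.
Unset Printing Implicit Defensive.

Import Order.TTheory GRing.Theory Num.Theory.
Import numFieldNormedType.Exports.

Local Open Scope classical_set_scope.
Local Open Scope ring_scope.

Lemma cvg_divn0 (R : realType) (c : R) :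
  (fun n : nat => c / n%:R) @ \oo --> (0 : R).
Proof.
rewrite -[X in _ --> X](mulr0 c); apply: cvgMl_tmp.
apply/cvgrVy; first by near=> n; rewrite invr_gt0 ltr0n; near: n; exists 1%N.
rewrite [X in X @ _ --> _](_ : _ = fun n : nat => n%:R); first exact: cvgr_idn.
by apply/funext => n; exact: invrK.
Unshelve. all: by end_near.
Qed.

(** For [k <> 0] this is a subsequence of one of the two limits, chosen by the sign of [k] and
    rescaled. It serves to follow [x] along the iterates of a shift. *)
Lemma rotation_number_mul (R : realType) (omega : R) (x : int -> R) (k : int) :
  has_rotation_number omega x ->
  (fun n : nat => x (n%:Z * k) / n%:R) @ \oo --> omega * k%:~R.
Proof.
move=> [xp xm]; rewrite mulrC; case: k => [[|k]|k].
- by under eq_fun do rewrite mulr0; rewrite mul0r; exact: cvg_divn0.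
- have /(cvgMl_tmp (a := k.+1%:R)) := cvg_comp _ _ (cvg_mulnl k.+1 isT) xp.
  apply: cvg_trans; apply: near_eq_cvg; near=> n.
  rewrite /= mulrC natrM invfM mulrAC -!mulrA mulVKf ?pnatr_eq0//.
  by rewrite PoszM [_ * k.+1%:Z]mulrC mulrC.
- have /(cvgMl_tmp (a := - k.+1%:R)) := cvg_comp _ _ (cvg_mulnl k.+1 isT) xm.
  rewrite NegzE rmorphN /=; apply: cvg_trans; apply: near_eq_cvg; near=> n.
  have -> : n%:Z * - k.+1%:Z = - (k.+1 * n)%N%:Z by lia.
  rewrite /= natrM invrN mulrN mulrNN invfM mulrCA; congr (_ * _).
  by rewrite mulVKf ?pnatr_eq0.
Unshelve. all: by end_near.
Qed.

Lemma birkhoff_shift_le (R : realType) (omega : R) (x : int -> R) (k l : int) :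
  birkhoff_rot omega x -> l%:~R < omega * k%:~R ->
  (Defs.shift k l x <= x)%O.
Proof.
move=> [xB xrot] lt_lk; case: (xB k l) => // /lefP le_x; exfalso.
(* If the shift were above [x], iterating it would bound the rotation number
   from the wrong side. *)
have iter_le n : x 0 <= x (n%:Z * (- k)) + n%:R * l%:~R.
  elim: n => [|n IH]; first by rewrite !mul0r addr0.
  apply: le_trans IH _; have := le_x (n%:Z * - k).
  rewrite /Defs.shift => /le_trans.
  have -> : n%:Z * - k - k = n.+1%:Z * - k by lia.
  move=> h; rewrite -lerBrDr; apply: h.
  by rewrite -[in leRHS]natr1 -[leLHS]addr0; lra.
have lim_shift : (fun n : nat => x (n%:Z * - k) / n%:R + l%:~R) @ \oo -->
    omega * (- k)%:~R + l%:~R.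
  by apply: cvgD; [exact: rotation_number_mul | exact: cvg_cst].
have : 0 <= omega * (- k)%:~R + l%:~R.
  apply: (ler_cvg_to (cvg_divn0 (x 0)) lim_shift).
  near=> n; have n_gt0 : 0 < n%:R :> R by rewrite ltr0n; near: n; exists 1%N.
  rewrite /= ler_pdivrMr// mulrDl divfK ?gt_eqF//.
  by rewrite mulrC [l%:~R * _]mulrC mulrC.
by rewrite rmorphN /= mulrN; lra.
Unshelve. all: by end_near.
Qed.

(** A strict inequality is decided by the rotation number. In a tie the shift by [(i' - i, l - l')]
    fixes [x], by maximal periodicity. *)
Lemma birkhoff_lift_le (R : realType) (omega : R) (x : int -> R)
    (i l i' l' : int) :
  birkhoff_rot omega x -> maximally_periodic omega x ->
  omega * i%:~R + l%:~R <= omega * i'%:~R + l'%:~R ->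
  x i + l%:~R <= x i' + l'%:~R.
Proof.
move=> xB xper; rewrite le_eqVlt => le_il.
have [/lefP/(_ i')] : (Defs.shift (i' - i) (l - l') x <= x)%O.
  case/orP: le_il => [/eqP eq_il|lt_il].
    rewrite xper // !rmorphB /=; lra.
  by apply: birkhoff_shift_le xB _; rewrite !rmorphB /=; lra.
rewrite /Defs.shift subKr rmorphB /=.
lra.
Qed.

(** The map [F] of the overview. The supremum extends it to all reals, since the points where it
    gets evaluated need not have the form [omega * i + l]. *)
Definition hull (R : realType) (omega : R) (x : int -> R) (t : R) : R :=
  sup [set x il.1 + il.2%:~R | il in
        [set il : int * int | omega * il.1%:~R + il.2%:~R <= t]].

Section Hull.
Variables (R : realType) (omega : R) (x : int -> R).
Hypotheses (xB : birkhoff_rot omega x) (xper : maximally_periodic omega x).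

Lemma hull_ge (i l : int) (t : R) :
  omega * i%:~R + l%:~R <= t -> x i + l%:~R <= hull omega x t.
Proof.
move=> le_t; apply: ub_le_sup; last by exists (i, l).
(* The lift of [x 0] at the integer [Num.ceil t] dominates every lift below [t], so the supremum is
   a genuine one. *)
exists (x 0 + (Num.ceil t)%:~R) => _ [[j m] /= jm_le <-].
apply: (birkhoff_lift_le xB xper).
by rewrite mulr0 add0r; apply: le_trans jm_le _; exact: ceil_ge.
Qed.

Lemma hull_le (t u : R) :
  (forall i l : int, omega * i%:~R + l%:~R <= t -> x i + l%:~R <= u) ->
  hull omega x t <= u.
Proof.
move=> ub; apply: ge_sup; last by move=> _ [[i l] /= ? <-]; exact: ub.
exists (x 0 + (Num.floor t)%:~R), (0, Num.floor t) => //=.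
by rewrite mulr0 add0r floor_le.
Qed.

Lemma hullE (i l : int) :
  hull omega x (omega * i%:~R + l%:~R) = x i + l%:~R.
Proof.
apply/le_anti/andP; split; last exact: hull_ge.
by apply: hull_le => j m; exact: birkhoff_lift_le.
Qed.

Lemma hull_homo (s t : R) : s <= t -> hull omega x s <= hull omega x t.
Proof.
by move=> st; apply: hull_le => i l il_le; apply: hull_ge; exact: le_trans st.
Qed.

Lemma hullD1 (t : R) : hull omega x (t + 1) = hull omega x t + 1.
Proof.
apply/le_anti/andP; split.
  apply: hull_le => i l le_t.
  have : x i + (l - 1)%:~R <= hull omega x t.
    by apply: hull_ge; rewrite rmorphB /=; lra.
  by rewrite rmorphB /=; lra.
rewrite -lerBrDr; apply: hull_le => i l le_t.
have : x i + (l + 1)%:~R <= hull omega x (t + 1).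
  by apply: hull_ge; rewrite rmorphD /=; lra.
by rewrite rmorphD /=; lra.
Qed.

End Hull.

Lemma sum_periodic_coprime (V : zmodType) (p : nat) (q b : int)
    (g : int -> V) :
  (0 < p)%N -> coprimez p%:Z q -> (forall l, g (l + p%:Z) = g l) ->
  \sum_(k < p) g (k%:Z * q + b) = \sum_(k < p) g k%:Z.
Proof.
move=> p_gt0 cop gp.
have gMn l (n : nat) : g (l + n%:Z * p%:Z) = g l.
  elim: n => [|n IH]; first by rewrite mul0r addr0.
  by rewrite -[RHS]IH -[RHS]gp; congr g; lia.
have gM l (n : int) : g (l + n * p%:Z) = g l.
  case: n => n; first exact: gMn.
  by rewrite -[LHS](gMn _ n.+1); congr g; lia.
have pZ : p%:Z != 0 by lia.
pose r (k : 'I_p) := ((k%:Z * q + b)%R %% p%:Z)%Z.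
have r_ge0 k : 0 <= r k by exact: modz_ge0.
have r_lt k : (`|r k| < p)%N.
  by rewrite -ltz_nat gez0_abs //; exact: ltz_pmod.
pose h k := Ordinal (r_lt k).
have h_inj : injective h.
  move=> k k' /(congr1 val) /= eq_r.
  have : (k%:Z * q + b == k'%:Z * q + b %[mod p%:Z])%Z.
    by apply/eqP; rewrite -/(r k) -/(r k') -(gez0_abs (r_ge0 k)) eq_r gez0_abs.
  rewrite eqz_mod_dvd.
  have -> : k%:Z * q + b - (k'%:Z * q + b) = (k%:Z - k'%:Z) * q by ring.
  rewrite Gauss_dvdzl // => /dvdzP [c ec].
  apply/val_inj => /=; have := ltn_ord k; have := ltn_ord k'.
  (* [k - k' = c * p] has absolute value below [p], which leaves only [c = 0]. *)
  have : c = 0 \/ 1 <= c \/ c <= -1 by lia.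
  by case=> [c0|[c1|c1]]; nia.
rewrite [RHS](reindex_inj h_inj) /=; apply: eq_bigr => k _.
by rewrite gez0_abs // [in LHS](divz_eq (k%:Z * q + b) p%:Z) addrC gM.
Qed.

(** Raising [a] by one adds [p] unit increments of [H], one for each residue modulo [p]. Put in
    order, they telescope to [H p - H 0 = 1]. *)
Lemma sum_increments (R : numDomainType) (p : nat) (q s : int) (a : nat)
    (H : int -> R) :
  (0 < p)%N -> coprimez p%:Z q -> (forall l, H (l + p%:Z) = H l + 1) ->
  \sum_(k < p) (H ((k%:Z + s) * q + a%:Z) - H ((k%:Z + s) * q)) = a%:R.
Proof.
move=> p_gt0 cop Hp; elim: a => [|a IH].
  by rewrite big1 // => k _; rewrite addr0 subrr.
rewrite -natr1 -[in RHS]IH.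
have <- : \sum_(k < p) (H (k%:Z * q + (s * q + a%:Z) + 1)
                        - H (k%:Z * q + (s * q + a%:Z))) = 1.
  rewrite (@sum_periodic_coprime _ p q _ (fun l => H (l + 1) - H l)) //.
    rewrite -(big_mkord xpredT (fun k => H (k%:Z + 1) - H k%:Z)).
    rewrite (eq_bigr (fun k : nat => H k.+1%:Z - H k%:Z)); last first.
      by move=> k _; rewrite -addn1 PoszD.
    rewrite (telescope_sumr (fun k : nat => H k%:Z)) //.
    by rewrite -[p%:Z]add0r Hp addrC addKr.
  by move=> l; rewrite Hp addrAC Hp; ring.
rewrite -big_split /=; apply: eq_bigr => k _.
have -> : (k%:Z + s) * q + a.+1%:Z = k%:Z * q + (s * q + a%:Z) + 1 by lia.
have -> : (k%:Z + s) * q + a%:Z = k%:Z * q + (s * q + a%:Z) by lia.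
by ring.
Qed.

Lemma exists_le_mean (R : realFieldType) (p : nat) (T : 'I_p -> R) :
  (0 < p)%N -> exists i, T i <= (\sum_k T k) / p%:R.
Proof.
move=> p_gt0; apply: contrapT => /forallNP gtT.
have : \sum_(k < p) (\sum_j T j) / p%:R < \sum_k T k.
  apply: ltr_sum; first by apply/hasP;
    exists (Ordinal p_gt0); rewrite ?mem_index_enum.
  by move=> i _; rewrite ltNge; apply/negP/gtT.
rewrite sumr_const card_ord -[X in X < _]mulr_natr.
by rewrite divfK ?ltxx ?pnatr_eq0 -?lt0n.
Qed.

(* The index j = i0 - r, ..., i0 + r - 1 is written i0 - r + j, j < 2 * r. *)
Theorem theorem3p2 (R : realType) (p : nat) (q : int) (omega : R)
    (r : nat) (i1 i2 : int) (x : int -> R)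
    (p_ge1 : (1 <= p)%N) (coprime_pq : coprimez p%:Z q)
    (r_ge1 : (1 <= r)%N) (le_i1_i2 : i1 <= i2)
    (x_B : birkhoff_rot omega x) (x_per : maximally_periodic omega x) :
  let a : int :=
    Num.ceil ((i2 - i1)%:~R * `|q%:~R - omega * p%:R|) in
  exists i0 : int, forall m n : int,
    i1 + r%:Z <= i0 + m * p%:Z <= i2 - r%:Z + 1 ->
    i1 + r%:Z <= i0 + n * p%:Z <= i2 - r%:Z + 1 ->
    \sum_(j < 2 * r)
      `| x (m * p%:Z + (i0 - r%:Z + j%:Z)) - x (n * p%:Z + (i0 - r%:Z + j%:Z))
         - ((m - n) * q)%:~R | <= 2 * r%:R * a%:~R / p%:R.
Proof.
move=> a.
have p_gt0 : 0 < p%:R :> R by rewrite ltr0n.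
have len_ge0 : 0 <= (i2 - i1)%:~R :> R by rewrite ler0z subr_ge0.
have [b ab] : exists b : nat, a = b%:Z.
  have : 0 <= a by rewrite ceil_ge0 (lt_le_trans (ltrN10 _))// mulr_ge0.
  by case: a => b // _; exists b.
have b_ge : (i2 - i1)%:~R * `|q%:~R - omega * p%:R| <= b%:R.
  by have := ceil_ge ((i2 - i1)%:~R * `|q%:~R - omega * p%:R|); rewrite -/a ab.
rewrite ab => {ab a}.
pose eps : R := omega - q%:~R / p%:R.
pose c : R := Num.min (eps * i1%:~R) (eps * i2%:~R).
have epsE : `|q%:~R - omega * p%:R| = `|eps| * p%:R.
  by rewrite distrC -[p%:R in RHS]normr_nat -normrM mulrBl divfK ?gt_eqF.
(* [eps * i] is monotone in [i], so its extremes lie at [i1] and [i2]; they differ by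
   [(i2 - i1) * |eps|], at most [b / p]. *)
have c_bound (i : int) : i1 <= i <= i2 ->
    c <= eps * i%:~R <= c + b%:R / p%:R.
  rewrite -!(ler_int R) => /andP[i1i ii2].
  have : (i2%:~R - i1%:~R) * `|eps| <= b%:R / p%:R.
    by rewrite ler_pdivlMr// -mulrA -epsE -rmorphB.
  rewrite /c; have [eps_ge0|eps_lt0] := leP 0 eps.
    have := ler_wpM2l eps_ge0 i1i; have := ler_wpM2l eps_ge0 ii2.
    by rewrite ger0_norm// => ? ? ?; rewrite min_l; lra.
  have := ler_wnM2l (ltW eps_lt0) i1i; have := ler_wnM2l (ltW eps_lt0) ii2.
  by rewrite ltr0_norm// => ? ? ?; rewrite min_r; lra.
(* Sampling with step [1 / p] turns the period 1 of the hull into the period [p] of the index. *)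
pose H (l : int) : R := hull omega x (l%:~R / p%:R + c).
have HDp l : H (l + p%:Z) = H l + 1.
  rewrite /H -(hullD1 x_B x_per); congr hull.
  by rewrite rmorphD mulrDl /= divff ?gt_eqF// addrAC.
pose G (k : int) : R := H (k * q + b%:Z) - H (k * q).
have x_bound (k m : int) : i1 <= m * p%:Z + k <= i2 ->
    H (k * q) <= x (m * p%:Z + k) - (m * q)%:~R <= H (k * q + b%:Z).
  move=> /c_bound /andP[lo hi].
  rewrite -rmorphN -(hullE x_B x_per) /=.
  have -> : omega * (m * p%:Z + k)%:~R + (- (m * q))%:~R
      = (k * q)%:~R / p%:R + eps * (m * p%:Z + k)%:~R.
    rewrite /eps !(rmorphN, rmorphD, rmorphM) /=.
    by field; rewrite gt_eqF.
  apply/andP; split; apply: hull_homo => //; first by rewrite lerD2l.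
  by rewrite [in leRHS]rmorphD [in leRHS]mulrDl -addrA lerD2l addrC.
(* The bounds in [x_bound] do not involve [m], so both normalised values lie in one interval of
   length [G k]. *)
have le_G (k m n : int) :
    i1 <= m * p%:Z + k <= i2 -> i1 <= n * p%:Z + k <= i2 ->
    `|x (m * p%:Z + k) - x (n * p%:Z + k) - ((m - n) * q)%:~R| <= G k.
  move=> /x_bound/andP[? ?] /x_bound/andP[? ?].
  by rewrite mulrBl rmorphB ler_norml /G /=; apply/andP; split; lra.
pose T (i : 'I_p) : R := \sum_(j < 2 * r) G (i%:Z - r%:Z + j%:Z).
have sumT : \sum_i T i = 2 * r%:R * b%:R.
  (* For fixed [j] the index [i] runs over a full period and contributes [b]; there are [2 * r]
     values of [j]. *)
  rewrite exchange_big /=.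
  under eq_bigr => j _.
    under eq_bigr do rewrite -addrA.
    rewrite (sum_increments _ _ p_ge1 coprime_pq HDp); over.
  by rewrite sumr_const card_ord -[LHS]mulr_natl natrM.
have [i Ti] := exists_le_mean T p_ge1; rewrite sumT in Ti.
exists i%:Z => m n hm hn; apply: le_trans Ti.
(* The window reaches from [i0 + m * p - r] to [i0 + m * p + r - 1], which the hypotheses on [m] and
   [n] keep inside [[i1, i2]]. *)
by apply: ler_sum => j _; apply: le_G; have := ltn_ord j; lia.
Qed.
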